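(* Let $q\in[1,\infty]$, let $A\in\mathcal{L}(\mathcal{H}(\Omega),L_q(\Omega))$, and let $p\in[1,\infty]$ be the Hölder conjugate of $q$. Then the adjoint operator $A^*\colon L_p(\Omega)\to\mathcal{H}(\Omega)$ is given by the integral operator $$(A^*w)(x):=\int_\Omega A_y(k(y,x))\,w(y)\,\mathrm{d}y\qquad\text{for all } w\in L_p(\Omega),\ x\in\Omega,$$ i.e., it holds $$\langle Af,w\rangle_{L_2(\Omega)}=\langle f,A^*w\rangle_{\mathcal{H}(\Omega)}\qquad\text{for all } f\in\mathcal{H}(\Omega),\ w\in L_p(\Omega).$$
   Context: $\Omega\subset\mathbb{R}^d$, $k\colon\Omega\times\Omega\to\mathbb{R}$ is a positive semi-definite kernel, and $\mathcal{H}(\Omega)$ is its reproducing kernel Hilbert space (RKHS), i.e. $k(\cdot,x)\in\mathcal{H}(\Omega)$ and $\langle f,k(\cdot,x)\rangle_{\mathcal{H}(\Omega)}=f(x)$ for all $x\in\Omega$, $f\in\mathcal{H}(\Omega)$. $L_p(\Omega)$ spaces are with respect to the Lebesgue measure. $\mathcal{L}(V,W)$ denotes bounded linear operators from $V$ to $W$. Standing assumption (Mercer): $(Tf)(x):=\int_\Omega k(x,y)f(y)\,\mathrm{d}y$ defines a linear integral operator $T\colon L_2(\Omega)\to L_2(\Omega)$ with countably many $L_2(\Omega)$-orthonormal eigenfunctions $\{\varphi_j\}_{j=1}^\infty$ and positive eigenvalues $\{\lambda_j\}_{j=1}^\infty$ such that $\{\lambda_j^{1/2}\varphi_j\}_{j=1}^\infty$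 is an orthonormal basis of $\mathcal{H}(\Omega)$; $T$ is injective, and every $f\in L_2(\Omega)$ satisfies $f=\sum_j\langle f,\varphi_j\rangle_{L_2(\Omega)}\varphi_j$. Notation: $A_y(k(y,x))$ means $(A\,k(\cdot,x))(y)$, i.e. $A$ applied to $k$ in the variable $y$. For $Af\in L_q(\Omega)$, $w\in L_p(\Omega)$, $\langle Af,w\rangle_{L_2(\Omega)}$ is notation for the duality pairing $\int_\Omega (Af)(x)w(x)\,\mathrm{d}x$, which is well defined by Hölder's inequality. *)

(* Defs.v *)
(* MathComp / MathComp-Analysis *)
From HB Require Import structures.
From mathcomp Require Import all_boot all_order all_algebra.
From mathcomp Require Import all_classical all_reals all_analysis.

Set Implicit Arguments.
Unset Strict Implicit.
Unset Printing Implicit Defensive.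

Import Order.TTheory GRing.Theory Num.Theory.
Import numFieldNormedType.Exports.

Local Open Scope classical_set_scope.
Local Open Scope ring_scope.

Section lebesgue_outer_measure.
Context (R : realType) (n : nat).
Local Open Scope ereal_scope.

Definition box (b : 'rV[R]_n * 'rV[R]_n) : set 'rV[R]_n :=
  [set x | forall i, (b.1 0 i <= x 0 i <= b.2 0 i)%R].

Definition box_volume (b : 'rV[R]_n * 'rV[R]_n) : \bar R :=
  (\prod_(i < n) Num.max 0 (b.2 0 i - b.1 0 i))%:E.

(* Covers may be finite or even empty, so that the outer measure of set0 is 0
   also for n = 0. *)
Definition box_cover (A : set 'rV[R]_n) : set (set ('rV[R]_n * 'rV[R]_n)) :=
  [set S | countable S /\ A `<=` \bigcup_(b in S) box b].

Definition lebesgue_outer (A : set 'rV[R]_n) : \bar R :=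
  ereal_inf [set \esum_(b in S) box_volume b | S in box_cover A].

Lemma box_volume_ge0 b : 0 <= box_volume b.
Proof. by rewrite lee_fin prodr_ge0// => i _; rewrite le_max lexx. Qed.

Lemma lebesgue_outer_ge0 A : 0 <= lebesgue_outer A.
Proof.
apply: le_ereal_inf_tmp => _ [S _ <-].
by apply: esum_ge0 => b _; exact: box_volume_ge0.
Qed.

Lemma lebesgue_outer0 : lebesgue_outer set0 = 0.
Proof.
apply/eqP; rewrite eq_le lebesgue_outer_ge0 andbT.
apply: ereal_inf_lbound; exists set0; last by rewrite esum_set0.
by split => //; exact: countable0.
Qed.

Lemma le_lebesgue_outer : {homo lebesgue_outer : A B / A `<=` B >-> A <= B}.
Proof.
move=> A B AB; apply/ereal_inf_le_tmp => _ [S [cS BS] <-].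
by exists S => //; split => //; exact: subset_trans BS.
Qed.

Lemma esum_bigcup_le (T : choiceType) (f : T -> \bar R) (S : (set T)^nat) :
  (forall x, 0 <= f x) ->
  \esum_(x in \bigcup_k S k) f x <= \sum_(k <oo) \esum_(x in S k) f x.
Proof.
move=> f0.
rewrite seqDU_bigcup_eq (nneseries_sum_bigcup (@trivIset_seqDU _ S) f0).
apply: lee_nneseries => [k _ _|k _]; first exact: esum_ge0.
apply: ge_ereal_sup => _ [X [finX XS] <-].
apply: ereal_sup_ubound; exists X => //; split => //.
exact: subset_trans (@subset_seqDU _ S k).
Qed.

Lemma lebesgue_outer_sigma_subadditive : sigma_subadditive lebesgue_outer.
Proof.
move=> A; have [[i ioo]|] := pselect (exists i, lebesgue_outer (A i) = +oo).
  rewrite (eseries_pinfty _ _ ioo) ?leey// => m _.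
  by rewrite -ltNye (lt_le_trans _ (lebesgue_outer_ge0 _)).
rewrite -forallNE => Aoo.
suff add2e (e : {posnum R}) : lebesgue_outer (\bigcup_m A m) <=
    \sum_(i <oo) lebesgue_outer (A i) + e%:num%:E.
  by apply/lee_addgt0Pr => _/posnumP[].
rewrite (le_trans _ (epsilon_trick _ _ _))//; last first.
  by move=> m; exact: lebesgue_outer_ge0.
have [G PG] : {G & forall m, box_cover (A m) (G m) /\
    \esum_(b in G m) box_volume b <=
    lebesgue_outer (A m) + (e%:num / (2 ^ m.+1)%:R)%:E}.
  apply: (@choice _ _ (fun m S => box_cover (A m) S /\
    \esum_(b in S) box_volume b <=
    lebesgue_outer (A m) + (e%:num / (2 ^ m.+1)%:R)%:E)) => m.
  have en1 : (0 < e%:num / (2 ^ m.+1)%:R :> R)%R by [].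
  have Afin : lebesgue_outer (A m) \is a fin_num.
    by rewrite ge0_fin_numE ?lebesgue_outer_ge0// ltey; exact/eqP/Aoo.
  have [x [S AS <-] xS] := lb_ereal_inf_adherent en1 Afin.
  by exists S; split => //; exact/ltW.
apply: (@le_trans _ _ (\sum_(k <oo) \esum_(b in G k) box_volume b)).
  apply: le_trans (esum_bigcup_le _ _); last exact: box_volume_ge0.
  apply: ereal_inf_lbound; exists (\bigcup_k G k) => //; split.
    by apply: bigcup_countable => // k _; have [[]] := PG k.
  move=> x [k _ Akx]; have [[_ /(_ x Akx)[b Gb xb]] _] := PG k.
  by exists b => //; exists k.
apply: lee_nneseries => [k _ _|k _]; last by have [] := PG k.
by apply: esum_ge0 => b _; exact: box_volume_ge0.
Qed.

HB.instance Definition _ := isOuterMeasure.Build R 'rV[R]_n lebesgue_outer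
  lebesgue_outer0 lebesgue_outer_ge0 le_lebesgue_outer
  lebesgue_outer_sigma_subadditive.

End lebesgue_outer_measure.

(* R^n with the sigma-algebra of its Lebesgue measurable sets. *)
Notation Rn R n := (caratheodory_type (@lebesgue_outer R n)).

Definition lebesgue_Rn (R : realType) (n : nat) : set (Rn R n) -> \bar R :=
  @lebesgue_outer R n.

HB.instance Definition _ (R : realType) (n : nat) :=
  isMeasure.Build _ (Rn R n) R (@lebesgue_Rn R n)
    (@caratheodory_measure0 R 'rV[R]_n (@lebesgue_outer R n))
    (@caratheodory_measure_ge0 R 'rV[R]_n (@lebesgue_outer R n))
    (@caratheodory_measure_sigma_additive R 'rV[R]_n (@lebesgue_outer R n)).

Section Lp_Omega.
Context (R : realType) (n : nat) (Omega : set (Rn R n)).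
Hypothesis mOmega : measurable Omega.

Definition lebesgue_on : set (Rn R n) -> \bar R :=
  mrestr (@lebesgue_Rn R n) mOmega.

HB.instance Definition _ := Measure.on lebesgue_on.

(* The elements are classes of functions on R^n modulo equality almost
   everywhere on Omega, that is, elements of L_p(Omega). *)
Definition Lp (p : \bar R) (p1 : (1 <= p)%E) := LspaceType lebesgue_on p1.

End Lp_Omega.

Section kernel.
Context (R : realType) (X : Type) (Omega : set X).

Definition psd_kernel (k : X -> X -> R) : Prop :=
  (forall x y, Omega x -> Omega y -> k x y = k y x) /\
  (forall (m : nat) (x : 'I_m -> X) (c : 'I_m -> R),
    (forall i, Omega (x i)) ->
    0 <= \sum_(i < m) \sum_(j < m) c i * c j * k (x i) (x j)).

(* A Hilbert space of functions on Omega: [rkhs_eval f x] is the value f(x)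
   and [rkhs_section x] is k(., x); only points of Omega are relevant. *)
Record rkhs (k : X -> X -> R) := RKHS {
  rkhs_space :> completeNormedModType R;
  rkhs_inner : {dot rkhs_space for idfun};
  rkhs_normE : forall f, `|f| ^+ 2 = rkhs_inner f f;
  rkhs_eval : rkhs_space -> X -> R;
  rkhs_evalP : forall (a : R) f g x, Omega x ->
    rkhs_eval (a *: f + g) x = a * rkhs_eval f x + rkhs_eval g x;
  rkhs_eval_inj : forall f g,
    (forall x, Omega x -> rkhs_eval f x = rkhs_eval g x) -> f = g;
  rkhs_section : X -> rkhs_space;
  rkhs_sectionE : forall x y, Omega x -> Omega y ->
    rkhs_eval (rkhs_section x) y = k y x;
  rkhs_reproducing : forall f x, Omega x ->
    rkhs_inner f (rkhs_section x) = rkhs_eval f x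
}.

Definition orthonormal_basis (k : X -> X -> R) (H : rkhs k) (e : nat -> H) :
    Prop :=
  (forall i j, rkhs_inner H (e i) (e j) = (i == j)%:R) /\
  (forall f : H, series (fun j => rkhs_inner H f (e j) *: e j) @ \oo --> f).

End kernel.

Section mercer.
Context (R : realType) (n : nat) (Omega : set (Rn R n)).
Hypothesis mOmega : measurable Omega.
Variables (k : Rn R n -> Rn R n -> R) (H : rkhs Omega k).
Local Notation mu := (lebesgue_on mOmega).
Local Notation L2 := (Lp mOmega (lee1n 2)).

(* [phiH j] is the element of H whose class in L_2(Omega) is [phi j]. *)
Record mercer (T : L2 -> L2) (phi : nat -> L2) (phiH : nat -> H)
    (lambda : nat -> R) : Prop := Mercer {
  mercer_integral : forall f : L2, \forall x \ae mu, Omega x ->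
    mu.-integrable Omega (fun y => (k x y * f y)%:E) /\
    T f x = \int[mu]_(y in Omega) (k x y * f y);
  mercer_injective : injective T;
  mercer_phi : forall j, phi j = rkhs_eval (phiH j) %[ae mu in Omega];
  mercer_orthonormal : forall i j,
    \int[mu]_(x in Omega) (phi i x * phi j x) = (i == j)%:R;
  mercer_eigen : forall j,
    T (phi j) = (fun x => lambda j * phi j x) %[ae mu in Omega];
  mercer_lambda_gt0 : forall j, 0 < lambda j;
  mercer_basis : orthonormal_basis (fun j => Num.sqrt (lambda j) *: phiH j);
  mercer_expansion : forall f : L2,
    (fun m : nat => 'N[mu]_2[(fun x => (f x - \sum_(j < m)
       (\int[mu]_(y in Omega) (f y * phi j y)) * phi j x)%:E)])%E @ \oo --> 0%E
}.

End mercer.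

Section adjoint.
Context (R : realType) (n : nat) (Omega : set (Rn R n)).
Hypothesis mOmega : measurable Omega.
Variables (k : Rn R n -> Rn R n -> R) (H : rkhs Omega k).
Variables (p q : \bar R) (p1 : (1 <= p)%E) (q1 : (1 <= q)%E).
Local Notation mu := (lebesgue_on mOmega).

Definition bounded_linear_to_Lp (A : H -> Lp mOmega q1) : Prop :=
  (forall (a : R) (f g : H),
    A (a *: f + g) = (fun x => a * A f x + A g x) %[ae mu in Omega]) /\
  (exists C : R, forall f : H, 'N[mu]_q[EFin \o A f] <= (C * `|f|)%:E)%E.

(* L_p(Omega) carries no vector space structure in the library: linearity is
   expressed on representatives. *)
Definition bounded_linear_from_Lp (B : Lp mOmega p1 -> H) : Prop :=
  (forall (a : R) (u v w : Lp mOmega p1),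
    w = (fun x => a * u x + v x) %[ae mu in Omega] -> B w = a *: B u + B v) /\
  (exists C : R, forall w, (`|B w|%:E <= C%:E * 'N[mu]_p[EFin \o w])%E).

Definition is_adjoint (A : H -> Lp mOmega q1) (B : Lp mOmega p1 -> H) : Prop :=
  bounded_linear_from_Lp B /\
  (forall (f : H) (w : Lp mOmega p1),
    \int[mu]_(x in Omega) (A f x * w x) = rkhs_inner H f (B w)).

End adjoint.

(* Main.v *)
(* By Hoelder's inequality, [f |-> \int A f * w] is a bounded linear functional on
   the Hilbert space [H] for every [w] in [L_p]; its Riesz representative is
   [Astar w]. Pairing [Astar w] with the sections [k(., x)] and using the
   reproducing property gives the integral formula. The Riesz representative of
   [L] is the minimizer of [J u = |u|^2 - 2 L u]. *)
Require Import Defs.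
From HB Require Import structures.
From mathcomp Require Import all_boot all_order all_algebra.
From mathcomp Require Import all_classical all_reals all_analysis.
From mathcomp Require Import measurable_realfun ess_sup_inf ring lra.

Set Implicit Arguments.
Unset Strict Implicit.
Unset Printing Implicit Defensive.

Import Order.TTheory GRing.Theory Num.Theory.
Import numFieldNormedType.Exports.

Local Open Scope classical_set_scope.
Local Open Scope ring_scope.

(** * Hölder's inequality and the duality pairing of [L_q] with [L_p], endpoint exponents
    included *)

Section Lspace_duality.
Context d (T : measurableType d) (R : realType) (mu : {measure set T -> \bar R}).
Local Open Scope ereal_scope.
Implicit Types f g : T -> R.

Lemma ae_le_Lnormy (f : T -> \bar R) :
  {ae mu, forall x, `|f x| <= 'N[mu]_+oo[f]}.
Proof.
rewrite unlock /Lnorm; case: ifPn => [_|]; first exact: ess_sup_ge.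
(* If the whole space is null, the sup norm defaults to 0, and the whole space serves as the
   exceptional set. *)
rewrite -leNgt => mu0; exists [set: T]; split => //.
by apply/eqP; rewrite eq_le mu0 measure_ge0.
Qed.

Lemma hoelder_1y f g : measurable_fun [set: T] f -> measurable_fun [set: T] g ->
  'N[mu]_1[EFin \o (f \* g)%R] <= 'N[mu]_1[EFin \o f] * 'N[mu]_+oo[EFin \o g].
Proof.
move=> mf mg.
have mabs (h : T -> R) : measurable_fun [set: T] h ->
    measurable_fun [set: T] (fun x => `|(h x)%:E|).
  by move=> mh; apply: measurableT_comp => //; exact/measurable_EFinP.
rewrite !Lnorm1 -ge0_integralZr//; [|exact: mabs|exact: Lnorm_ge0].
apply: ae_ge0_le_integral => //.
- by apply: mabs; exact: measurable_funM.
- by move=> x _; apply: mule_ge0 => //; exact: Lnorm_ge0.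
- by apply: emeasurable_funM => //; exact: mabs.
- apply: filterS (ae_le_Lnormy (EFin \o g)) => x gx _.
  by rewrite /= normrM EFinM lee_wpmul2l// lee_fin.
Qed.

(** The endpoints [q = 1] and [q = +oo] reduce to [hoelder_1y], the latter after swapping the
    factors; otherwise both exponents are finite and [hoelder] applies. *)
Lemma ehoelder (p q : \bar R) f g : p = hoelder_conjugate q -> 1 <= q ->
  measurable_fun [set: T] f -> measurable_fun [set: T] g ->
  'N[mu]_1[EFin \o (f \* g)%R] <= 'N[mu]_q[EFin \o f] * 'N[mu]_p[EFin \o g].
Proof.
move=> -> q1 mf mg.
have fgC : (f \* g = g \* f)%R by apply/funext => x; rewrite /= mulrC.
case: q q1 => [q| |//]; last first.
  by rewrite hoelder_conjugatey fgC muleC => _; exact: hoelder_1y.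
rewrite le_eqVlt => /predU1P[<-|q1].
  by rewrite hoelder_conjugate1; exact: hoelder_1y.
have q0 : (0 < q)%R by rewrite (lt_trans ltr01).
have := @hoelder_conj_ge1 R q%:E (ltW q1).
have := @hoelder_conjugate_eq1 R q%:E (ltNyr q).
rewrite eqe gt_eqF//= => /(_ isT).
case: (hoelder_conjugate q%:E) => [r pq r1| |//].
  have r0 : (0 < r)%R by rewrite (lt_le_trans ltr01).
  apply: hoelder => //; apply: EFin_inj.
  by move: pq; rewrite !inver !gt_eqF.
(* An infinite conjugate would force [1/q = 1], against [1 < q]. *)
by rewrite invey adde0 inver gt_eqF// => -[] /eqP; rewrite invr_eq1 gt_eqF.
Qed.

(* [R] and [measurableTypeR R] carry distinct measurable structures, which only
   become convertible once [measurable_fun] is unfolded. *)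
Lemma measurable_Lspace p (p1 : 1 <= p) (f : LspaceType mu p1) :
  measurable_fun [set: T] (f : T -> R).
Proof.
move=> mT Y mY.
exact: (@measurable_funPT _ _ _ _
  (repr (f : {mfun_ mu, T >-> measurableTypeR R})) mT Y mY).
Qed.

Section pairing.
Variables (D : set T) (mD : measurable D) (p q : \bar R).
Variables (p1 : 1 <= p) (q1 : 1 <= q) (hpq : p = hoelder_conjugate q).
Variables (f : LspaceType mu q1) (g : LspaceType mu p1).

Let mf := measurable_Lspace f.
Let mg := measurable_Lspace g.

Let Nfg_lty : 'N[mu]_1[EFin \o (f \* g)%R] < +oo.
Proof.
apply: (le_lt_trans (ehoelder hpq q1 mf mg)).
apply: lte_mul_pinfty; [exact: Lnorm_ge0| |exact: Lebesgue_finite].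
rewrite ge0_fin_numE ?Lnorm_ge0//; exact: Lebesgue_finite.
Qed.

Lemma Lspace_mul_integrable : mu.-integrable D (EFin \o (f \* g)%R).
Proof.
apply: (@integrableS _ _ _ _ setT) => //; apply/integrableP; split.
  by apply/measurable_EFinP; exact: measurable_funM.
by rewrite -Lnorm1.
Qed.

Lemma normr_Lspace_pairing_le :
  `|\int[mu]_(x in D) (f x * g x)|%:E <=
  'N[mu]_q[EFin \o f] * 'N[mu]_p[EFin \o g].
Proof.
apply: le_trans (ehoelder hpq q1 mf mg).
rewrite Lnorm1 EFin_normr_Rintegral//; last exact: Lspace_mul_integrable.
apply: le_trans (le_abse_integral _ _ _) _ => //.
  by case/integrableP: Lspace_mul_integrable.
apply: ge0_subset_integral => //; apply: measurableT_comp => //.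
by apply/measurable_EFinP; exact: measurable_funM.
Qed.
End pairing.

(** Serves twice: for [f |-> A f] with [w] fixed, and, with [p] and [q] exchanged, for [w] with
    [A f] fixed. *)
Lemma Lspace_pairing_linearl (D : set T) (p q : \bar R) (p1 : 1 <= p)
    (q1 : 1 <= q) (a : R) (u v f : LspaceType mu q1) (g : LspaceType mu p1) :
  measurable D -> p = hoelder_conjugate q ->
  f = (fun x => a * u x + v x)%R %[ae mu in D] ->
  (\int[mu]_(x in D) (f x * g x) =
   a * \int[mu]_(x in D) (u x * g x) + \int[mu]_(x in D) (v x * g x))%R.
Proof.
move=> mD hpq fuv.
have iug : mu.-integrable D (EFin \o (u \* g)%R).
  exact: Lspace_mul_integrable.
have ivg : mu.-integrable D (EFin \o (v \* g)%R).
  exact: Lspace_mul_integrable.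
rewrite -RintegralZl// -RintegralD//; last first.
  by have := integrableZl mD a iug.
have mL (r : \bar R) (r1 : 1 <= r) (h : LspaceType mu r1) :
    measurable_fun D (h : T -> R).
  exact/measurable_funTS/measurable_Lspace.
congr fine; apply: ae_eq_integral => //.
- by apply/measurable_EFinP; apply: measurable_funM; exact: mL.
- apply/measurable_EFinP; apply: measurable_funD.
    by apply: measurable_funM => //; apply: measurable_funM; exact: mL.
  by apply: measurable_funM; exact: mL.
- by apply: filterS fuv => x fx Dx; rewrite fx// mulrDl mulrA.
Qed.
End Lspace_duality.

(** * Riesz representation of a bounded linear functional *)

Section riesz.
Context (R : realType) (V : completeNormedModType R).
Variables (ip : {dot V for idfun}) (L : {scalar V}) (C : R).
Hypothesis normE : forall f, `|f| ^+ 2 = ip f f.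
Hypothesis L_bounded : forall f, `|L f| <= C * `|f|.

Let J u := `|u| ^+ 2 - 2 * L u.

Let LD u v : L (u + v) = L u + L v. Proof. exact: linearD. Qed.
Let LZ a v : L (a *: v) = a * L v. Proof. exact: linearZ. Qed.
Let ipZr a u v : ip u (a *: v) = a * ip u v. Proof. exact: linearZr_LR. Qed.

Let normD u v : `|u + v| ^+ 2 = `|u| ^+ 2 + 2 * ip u v + `|v| ^+ 2.
Proof. by rewrite !normE hnormD/= expr0 mul1r; ring. Qed.

(** This is the parallelogram law: by linearity the [L] terms on the right cancel. *)
Let norm_subE u v : `|u - v| ^+ 2 = 2 * J u + 2 * J v - 4 * J (2^-1 *: (u + v)).
Proof.
rewrite /J LZ LD normrZ exprMn ger0_norm ?invr_ge0//.
by rewrite -scaleN1r !normD scaleN1r normrN -scaleN1r ipZr; field.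
Qed.

(** Completing the square: [|u|^2 - 2 C |u| >= - C^2]. *)
Let J_lb u : - C ^+ 2 <= J u.
Proof.
have := L_bounded u; rewrite ler_norml => /andP[_ Lu].
have := sqr_ge0 (`|u| - C); rewrite /J; nra.
Qed.

Let m := inf (range J).

Let has_infJ : has_inf (range J).
Proof.
split; first by exists (J 0), 0.
by exists (- C ^+ 2) => _ [u _ <-].
Qed.

Let m_lb u : m <= J u.
Proof. by apply: ge_inf; [exact: has_infJ.2|exists u]. Qed.

Let minimizing : {u : V ^nat & forall n, J (u n) < m + n.+1%:R^-1}.
Proof.
apply: (@choice _ _ (fun n v => J v < m + n.+1%:R^-1)) => n.
have n0 : 0 < n.+1%:R^-1 :> R by rewrite invr_gt0.
by have [_ [v _ <-] ?] := inf_adherent n0 has_infJ; exists v.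
Qed.

Lemma riesz_representation : exists g, forall f, L f = ip f g.
Proof.
have [u um] := minimizing.
(* [norm_subE] makes a minimizing sequence of [J] a Cauchy sequence *)
have ucvg : cvg (u @ \oo).
  apply/cauchy_cvgP/cauchy_exP => e e0.
  (* Since [J >= m] at the midpoint, [|u N - u n|^2 < 2/(N+1) + 2/(n+1)], so each reciprocal has to
     be below [e^2/4]. *)
  have e20 : 0 < e ^+ 2 / 4 by rewrite divr_gt0// exprn_gt0.
  have [N _ Ne] := near_infty_natSinv_lt (PosNum e20).
  exists (u N); exists N => // n Nn; rewrite /= -ball_normE/=.
  rewrite -(ltr_pXn2r (n := 2))// ?nnegrE ?normr_ge0 ?ltW// norm_subE.
  have := um N; have := um n; have := m_lb (2^-1 *: (u N + u n)).
  have := Ne N (leqnn _); have := Ne n Nn; rewrite /=.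
  by move: (J _) (J _) (J _) m (n.+1%:R^-1) (N.+1%:R^-1) => *; lra.
have Lcont : continuous (L : V -> R).
  apply: (@bounded_linear_continuous _ V R^o).
  apply/linear_boundedP; near=> r => x.
  by rewrite (le_trans (L_bounded x))// ler_wpM2r.
(* By continuity of [J], the bounds [J (u n) < m + 1/(n+1)] pass to the limit. *)
have Jmin : J (lim (u @ \oo)) <= m.
  have Ju : J (u n) @[n --> \oo] --> J (lim (u @ \oo)).
    apply: cvgB; last by apply: cvgMl_tmp; apply: continuous_cvg => //; exact: Lcont.
    rewrite expr2; under eq_fun do rewrite expr2.
    by apply: cvgM; apply: cvg_norm.
  apply: (ler_cvg_to Ju (g := fun n => m + harmonic n)).
    rewrite -[X in _ --> X]addr0.
    by apply: cvgD; [exact: cvg_cst|exact: cvg_harmonic].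
  by apply: nearW => n; exact: ltW.
(* first-order condition for the minimizer [g] of [J] along [f], tested at the
   explicit step [t] *)
exists (lim (u @ \oo)) => f; set g := lim _.
apply/eqP; rewrite -subr_eq0; apply/eqP; set a := L f - _.
(* The added 1 keeps the denominator positive even for [f = 0]. *)
pose t := a / (`|f| ^+ 2 + 1).
have f1 : 0 < `|f| ^+ 2 + 1 by rewrite ltr_wpDl// exprn_ge0.
have := le_trans Jmin (m_lb (g + t *: f)).
rewrite /J normD LD LZ ipZr hermC/= expr0 mul1r normrZ exprMn.
rewrite real_normK ?num_real//.
have -> : ip f g = L f - a by rewrite /a; ring.
have : t * (`|f| ^+ 2 + 1) = a by rewrite /t divfK ?gt_eqF.
have := sqr_ge0 t.
move: t f1; set b := `|f| ^+ 2 => t b1 t2 <- H.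
(* Minimality reads [0 <= t^2 b - 2 t a]; substituting [a = t (b + 1)] turns the right-hand side
   into [- t^2 (b + 2)]. *)
have : t ^+ 2 * (b + 2) <= 0 by rewrite -/g in H; nra.
rewrite pmulr_lle0 ?ltr_wpDl// ?exprn_ge0// => t2'.
have /eqP : t ^+ 2 = 0 by apply/eqP; rewrite eq_le t2' t2.
by rewrite sqrf_eq0 => /eqP ->; rewrite mul0r.
Unshelve. all: by end_near. Qed.
End riesz.

(** * Symmetry and nondegeneracy of the RKHS inner product *)

Section rkhs_inner.
Context (R : realType) (X : Type) (Omega : set X) (k : X -> X -> R).
Variable H : rkhs Omega k.

Lemma rkhs_innerC (u v : H) : rkhs_inner H u v = rkhs_inner H v u.
Proof. by rewrite hermC/= expr0 mul1r. Qed.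

(** Testing with [f = u - v] gives [|u - v|^2 = 0]. *)
Lemma rkhs_inner_injr (u v : H) :
  (forall f, rkhs_inner H f u = rkhs_inner H f v) -> u = v.
Proof.
move=> uv; apply/eqP; rewrite -subr_eq0 -normr_eq0 -sqrf_eq0 rkhs_normE.
by rewrite linearBr/= uv subrr.
Qed.
End rkhs_inner.

(** * Construction, integral formula and uniqueness of the adjoint *)

Theorem proposition19 (R : realType) (d : nat)
    (Omega : set (Rn R d)) (mOmega : measurable Omega)
    (k : Rn R d -> Rn R d -> R) (hk : psd_kernel Omega k)
    (H : rkhs Omega k)
    (T : Lp mOmega (lee1n 2) -> Lp mOmega (lee1n 2))
    (phi : nat -> Lp mOmega (lee1n 2)) (phiH : nat -> H) (lambda : nat -> R)
    (hmercer : mercer T phi phiH lambda)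
    (p q : \bar R) (p1 : (1 <= p)%E) (q1 : (1 <= q)%E)
    (hpq : p = hoelder_conjugate q)
    (A : H -> Lp mOmega q1) (hA : bounded_linear_to_Lp A) :
  exists Astar : Lp mOmega p1 -> H,
    (forall (w : Lp mOmega p1) (x : Rn R d), Omega x ->
      rkhs_eval (Astar w) x =
      \int[lebesgue_on mOmega]_(y in Omega) (A (rkhs_section H x) y * w y)) /\
    (forall (f : H) (w : Lp mOmega p1),
      \int[lebesgue_on mOmega]_(x in Omega) (A f x * w x) =
      rkhs_inner H f (Astar w)) /\
    unique (is_adjoint A) Astar.
Proof.
have [Alin [C AC]] := hA.
pose L (w : Lp mOmega p1) f : R :=
  \int[lebesgue_on mOmega]_(x in Omega) (A f x * w x).
have L_linear (w : Lp mOmega p1) : linear_for *%R (L w).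
  by move=> a f g; exact: (Lspace_pairing_linearl w mOmega hpq (Alin a f g)).
pose N (w : Lp mOmega p1) := fine 'N[lebesgue_on mOmega]_p[EFin \o w]%E.
have NE (w : Lp mOmega p1) : 'N[lebesgue_on mOmega]_p[EFin \o w]%E = (N w)%:E.
  by rewrite fineK// ge0_fin_numE ?Lnorm_ge0//; exact: Lebesgue_finite.
have N_ge0 (w : Lp mOmega p1) : 0 <= N w by rewrite fine_ge0// Lnorm_ge0.
have L_bound (w : Lp mOmega p1) f : `|L w f| <= C * `|f| * N w.
  rewrite -lee_fin [leRHS]EFinM -NE.
  apply: le_trans (normr_Lspace_pairing_le mOmega hpq (A f) w) _.
  by apply: lee_wpmul2r; [exact: Lnorm_ge0|exact: AC].
have /choice[B LB] w : exists g : H, forall f, L w f = rkhs_inner H f g.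
  pose Lw : {scalar H} := HB.pack (L w)
    (GRing.isLinear.Build R H R *%R (L w) (L_linear w)).
  apply: (@riesz_representation _ _ (rkhs_inner H) Lw (C * N w)).
  - exact: rkhs_normE.
  - by move=> f; rewrite mulrAC; exact: L_bound.
exists B; split; [|split; [by move=> f w; exact: LB|split; [split; last by move=> f w; exact: LB|]]].
- by move=> w x Ox; rewrite -rkhs_reproducing// rkhs_innerC -LB.
- split=> [a u v w wuv|].
    apply: rkhs_inner_injr => f; rewrite linearD/= linearZr_LR/= -!LB /L.
    (* Commuting the factors makes [A f] the fixed one; conjugation of exponents being an
       involution, the linearity lemma applies with the exponents exchanged. *)
    have LC w' : L w' f = \int[lebesgue_on mOmega]_(x in Omega) (w' x * A f x).
      by apply: eq_Rintegral => x _; rewrite mulrC.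
    rewrite -/(L w f) -/(L u f) -/(L v f) !LC.
    by apply: (Lspace_pairing_linearl (A f) mOmega) => //;
      rewrite hpq hoelder_conjugateK.
  (* Taking [f = B w] gives [|B w|^2 = L w (B w) <= C |B w| N w], and one factor [|B w|] cancels.
     The absolute value covers [B w = 0], where the sign of [C] is unknown. *)
  exists `|C| => w.
  have [->|Bw0] := eqVneq (B w) 0; first by rewrite normr0 mule_ge0// Lnorm_ge0.
  have Bw_gt0 : 0 < `|B w| by rewrite normr_gt0.
  have := L_bound w (B w).
  rewrite NE -EFinM lee_fin LB -rkhs_normE normrX normr_id expr2 mulrAC.
  by rewrite ler_pM2r// => /le_trans; apply; rewrite ler_wpM2r// ler_norm.
(* The pairing identity alone determines each value [B' w], by nondegeneracy. *)
- move=> B' [_ LB']; apply/funext => w; apply: rkhs_inner_injr => f.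
  by rewrite -LB -LB'.
Qed.
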